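(* Let $G = (V,E)$ be a finite, simple, undirected graph with $n = |V|$ vertices and $m = |E|$ edges, and with a dominating clique $K$ of order $k = |K| \geq 3$. If $m \geq 3(n-k) - 2 + \frac{k(k-1)}{2}$, then $G$ is $3$-antimagic.
   Context: All graphs are finite, simple and undirected. A clique in $G=(V,E)$ is a set of vertices inducing a complete subgraph of $G$. A clique $K \subseteq V$ is a dominating clique if every vertex $v \in V \setminus K$ has a neighbor in $K$. The same symbol $K$ denotes the clique and its vertex set. Let $m = |E|$ and let $C \geq 0$ be an integer. Given a labelling $f : E \to \{1,2,\ldots,m+C\}$, for each vertex $u \in V$ let $\sigma(u) = \sum_{v \in V,\ uv \in E} f(uv)$ be the sum of the labels of the edges incident to $u$. The graph $G$ is $C$-antimagic if there exists an injective labelling $f : E \to \{1,2,\ldots,m+C\}$ such that the values $\sigma(u)$, $u \in V$, are pairwise distinct. *)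

(* Defs.v *)
(* A finite simple graph is a symmetric irreflexive [adj : rel V] on a
   [V : finType]. *)
From mathcomp Require Import all_boot.
Set Implicit Arguments.
Unset Strict Implicit.
Unset Printing Implicit Defensive.

Section Graph.
Variables (V : finType) (adj : rel V).

(* The undirected edge uv is the two-element set [set u; v]. *)
Definition edges : {set {set V}} :=
  [set [set p.1; p.2] | p : V * V & adj p.1 p.2].

Definition clique (K : {set V}) : Prop :=
  {in K &, forall u v, u != v -> adj u v}.

Definition dominating (K : {set V}) : Prop :=
  forall v, v \notin K -> exists2 u, u \in K & adj u v.

Definition dominating_clique (K : {set V}) : Prop :=
  clique K /\ dominating K.

(* Labellings are functions on all of {set V}; only their values on [edges]
   matter. *)
Definition labelling (C : nat) (f : {set V} -> nat) : Prop :=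
  {in edges, forall x, 1 <= f x <= #|edges| + C}.

Definition sigma (f : {set V} -> nat) (u : V) : nat :=
  \sum_(v | adj u v) f [set u; v].

Definition antimagic (C : nat) : Prop :=
  exists f : {set V} -> nat,
    [/\ labelling C f, {in edges &, injective f} & injective (sigma f)].

End Graph.

(* Main.v *)
Require Import Defs.
From mathcomp Require Import all_boot zify.

(* Write m' for the number of edges not inside K.  Every vertex v outside K
   reserves one edge to K.  The unreserved edges not inside K get labels from
   {1,..,m'} outside {1,4,7,..}, and the reserved edges then get 1,4,7,.. in the
   order of the partial sums of their outer endpoints, so that the sums of any
   two vertices outside K differ by at least 3; the hypothesis on m is what makes
   these labels fit into {1,..,m'}.  The edges inside K are labelled last, from
   {m'+1,..,m+3}.  Sort K by the sums contributed from outside.  Labelling the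
   stars of K lexicographically makes the sums on K increasing, and exchanging
   the last label of a star with the next integer moves the sum at its centre by
   one, which suffices to avoid the sums outside K; the three largest vertices
   are treated by choosing three out of five consecutive labels. *)

Set Implicit Arguments.
Unset Strict Implicit.
Unset Printing Implicit Defensive.

(** * Avoiding a set of integers with gaps of at least three *)

Definition sparse3 (S : pred nat) : Prop :=
  forall x y, x \in S -> y \in S -> x < y -> x + 3 <= y.

Lemma sparse3_notin (S : pred nat) (x y : nat) :
  sparse3 S -> x \in S -> x < y + 3 -> y < x + 3 -> x != y -> y \notin S.
Proof.
move=> spS Sx ltxy ltyx nxy; apply/negP => Sy.
have := spS x y Sx Sy; have := spS y x Sy Sx; move/eqP: nxy; lia.
Qed.

(** Two triples that suit [p] and [q] and whose values of [y + z] differ by one or two cannot both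
    fail at [r]. Membership of [q + 6], [p + 3] and [p + 5] decides which two triples to compare: a
    number in [S] frees those at distance one or two. *)
Lemma sparse3_triangle (S : pred nat) (p q r : nat) : sparse3 S ->
  exists x y z, [/\ 0 < x, x < y, y < z & z <= 5] /\
    [/\ p + (x + y) \notin S, q + (x + z) \notin S & r + (y + z) \notin S].
Proof.
move=> spS.
have off (a i j : nat) :
    a + i \in S -> i != j -> i < j + 3 -> j < i + 3 -> a + j \notin S.
  by move=> Sa /eqP ij lij lji; apply: (sparse3_notin spS Sa); lia.
have pick (x y z x' y' z' : nat) :
    [/\ 0 < x, x < y, y < z & z <= 5] ->
    [/\ 0 < x', x' < y', y' < z' & z' <= 5] ->
    p + (x + y) \notin S -> p + (x' + y') \notin S ->
    q + (x + z) \notin S -> q + (x' + z') \notin S ->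
    [/\ y + z != y' + z', y + z < y' + z' + 3 & y' + z' < y + z + 3] ->
    exists x y z, [/\ 0 < x, x < y, y < z & z <= 5] /\
      [/\ p + (x + y) \notin S, q + (x + z) \notin S & r + (y + z) \notin S].
  move=> b b' p1 p2 q1 q2 [nr l1 l2].
  have [Sr|Sr] := boolP (r + (y + z) \in S); last by exists x, y, z.
  by exists x', y', z'; split=> //; split=> //; apply: off Sr _ _ _.
have [Sq|Sq] := boolP (q + 6 \in S).
  have [Sp|Sp] := boolP (p + 3 \in S).
    by apply: (pick 1 3 4 2 3 5); rewrite //; (apply: off Sp _ _ _ || apply: off Sq _ _ _).
  by apply: (pick 1 2 3 1 2 4); rewrite //; apply: off Sq _ _ _.
have [Sp|Sp] := boolP (p + 5 \in S).
  by apply: (pick 1 2 5 1 3 5); rewrite //; apply: off Sp _ _ _.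
by apply: (pick 1 4 5 2 3 4).
Qed.

(** * Labelling the clique star by star *)

Section CliqueLabelling.
Variable V : finType.
Implicit Types (s : seq V) (w g : V -> nat) (f : {set V} -> nat) (e : {set V}).

Definition pair_in s e := (#|e| == 2) && [forall x in e, x \in s].

(** The weight [w x] stands for the labels already received by [x], from outside [K] and from the
    stars removed so far. *)
Definition total w f s x := w x + \sum_(y <- s | y != x) f [set x; y].

Lemma pair_in_set2 s x y :
  x != y -> x \in s -> y \in s -> pair_in s [set x; y].
Proof.
move=> nxy xs ys; rewrite /pair_in cards2 nxy /=; apply/forall_inP => z.
by rewrite !inE => /orP[]/eqP->.
Qed.

Lemma pair_in_cons u s e : u \notin s -> pair_in (u :: s) e ->
  (exists2 x, x \in s & e = [set u; x]) \/ (u \notin e /\ pair_in s e).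
Proof.
move=> us /andP[/cards2P[x [y [nxy ->]]] /forall_inP sub].
have := sub x; have := sub y; rewrite !inE !eqxx orbT /= => /(_ isT) ys /(_ isT) xs.
have [xu|xu] := eqVneq x u.
  by left; exists y; [move: ys; rewrite -xu eq_sym (negPf nxy) | rewrite xu].
have [yu|yu] := eqVneq y u.
  left; exists x; first by move: xs; rewrite (negPf xu).
  by rewrite yu setUC.
right; split=> //.
apply: pair_in_set2 => //; first by move: xs; rewrite (negPf xu).
by move: ys; rewrite (negPf yu).
Qed.

(** On an edge [[set u; x]] the sum has the single term [g x]: summing is a way to name the other
    endpoint. *)
Definition add_star u g f e := if u \in e then \sum_(x in e :\ u) g x else f e.

Lemma add_star1 u g f x : x != u -> add_star u g f [set u; x] = g x.
Proof.
move=> xu; rewrite /add_star !inE eqxx /=.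
by rewrite setU1K ?big_set1 // inE eq_sym.
Qed.

Lemma total_add_star u w g f s : u \notin s ->
  total w (add_star u g f) (u :: s) u = w u + \sum_(x <- s) g x.
Proof.
move=> us; rewrite /total big_cons eqxx /=; congr (_ + _).
rewrite big_seq_cond [RHS]big_seq_cond; apply: eq_big => x.
  by rewrite andbT; case: (x \in s) / boolP => //= xs; apply: contraNneq us => <-.
by case/andP=> xs xu; rewrite add_star1.
Qed.

(** A labelled star becomes additional weight on the remaining vertices, so the induction can forget
    its centre. *)
Lemma total_add_star_neq u w g f s v : u \notin s -> v \in s ->
  total w (add_star u g f) (u :: s) v = total (fun x => w x + g x) f s v.
Proof.
move=> us vs; have vu : v != u by apply: contraNneq us => <-.
rewrite /total big_cons eq_sym vu [[set v; u]]setUC add_star1 // addnA.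
congr (_ + _); rewrite big_seq_cond [RHS]big_seq_cond; apply: eq_bigr => y.
case/andP=> ys _; rewrite /add_star !inE eq_sym (negPf vu) /=.
by case: eqP => // uy; rewrite uy ys in us.
Qed.

Lemma add_star_inj u g f s : u \notin s ->
  {in pair_in s &, injective f} -> {in s &, injective g} ->
  (forall x e, x \in s -> pair_in s e -> g x <> f e) ->
  {in pair_in (u :: s) &, injective (add_star u g f)}.
Proof.
move=> us fI gI gf e1 e2 /(pair_in_cons us) e1s /(pair_in_cons us) e2s.
have ne x : x \in s -> x != u by move=> xs; apply: contraNneq us => <-.
have stay e : u \notin e -> add_star u g f e = f e.
  by rewrite /add_star => /negPf->.
case: e1s e2s => [[x xs ->]|[ue1 e1s]] [[y ys ->]|[ue2 e2s]].
- by rewrite !add_star1 ?ne // => /gI->.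
- by rewrite add_star1 ?ne // stay // => /gf; case.
- by rewrite add_star1 ?ne // stay // => /esym/gf; case.
- by rewrite !stay //; apply: fI.
Qed.

Lemma add_star_ind u g f s (P : pred nat) : u \notin s ->
  {in s, forall x, P (g x)} -> {in pair_in s, forall e, P (f e)} ->
  {in pair_in (u :: s), forall e, P (add_star u g f e)}.
Proof.
move=> us Pg Pf e /(pair_in_cons us)[[x xs ->]|[ue es]].
  by rewrite add_star1 ?Pg //; apply: contraNneq us => <-.
by rewrite /add_star (negPf ue) Pf.
Qed.

Variables (S : pred nat) (spS : sparse3 S).

(* The labels available to the clique [s] are [c], left over from the previous
   star, and the integers from [d+1] to [b].  The lower bound on the sums keeps
   them above the sum of a vertex whose star has already been labelled. *)
Definition good_labelling w s (c d b : nat) f :=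
  [/\ {in pair_in s &, injective f},
      {in pair_in s, forall e, ((f e == c) || (d < f e)) && (f e <= b)},
      {in s &, injective (total w f s)},
      {in s, forall x, total w f s x \notin S} &
      {in s, forall x, w x + c + (size s - 2) * d.+1 <= total w f s x}].

(** The edges [uv], [ut], [vt] get [d + x], [d + y], [d + z] with [x < y < z]. As
    [x + y < x + z < y + z], the totals increase along with the weights. *)
Lemma good_labelling3 w u v t (c d : nat) : uniq [:: u; v; t] ->
  w u <= w v -> w v <= w t -> c <= d ->
  exists f, good_labelling w [:: u; v; t] c d (d + 5) f.
Proof.
move=> us wuv wvt cd.
have [x [y [z [[x0 xy yz z5] [Su Sv St]]]]] :=
  sparse3_triangle (w u + (d + d)) (w v + (d + d)) (w t + (d + d)) spS.
pose g a := if a == v then d + x else d + y.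
pose f := add_star u g (fun=> d + z); exists f.
have [uvt vt] : u \notin [:: v; t] /\ v != t.
  by move: us; rewrite /= => /and3P[->]; rewrite inE.
have gv : g v = d + x by rewrite /g eqxx.
have gt : g t = d + y by rewrite /g eq_sym (negPf vt).
have pvt e : pair_in [:: v; t] e -> e = [set v; t].
  move/(pair_in_cons _); rewrite inE => /(_ vt)[[a]|[_]].
    by rewrite inE => /eqP->.
  move/(pair_in_cons _) => /(_ isT)[[a]//|[_]].
  case/andP=> /cards2P[a [b [_ ->]]] /forall_inP/(_ a).
  by rewrite !inE eqxx => /(_ isT).
have Tu : total w f [:: u; v; t] u = w u + (d + d) + (x + y).
  rewrite total_add_star // !big_cons big_nil gv gt; lia.
have Tv : total w f [:: u; v; t] v = w v + (d + d) + (x + z).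
  rewrite (total_add_star_neq _ _ _ uvt) ?inE ?eqxx // /total !big_cons big_nil eqxx.
  rewrite eq_sym vt gv /=; lia.
have Tt : total w f [:: u; v; t] t = w t + (d + d) + (y + z).
  rewrite (total_add_star_neq _ _ _ uvt) ?inE ?eqxx ?orbT // /total !big_cons big_nil eqxx.
  rewrite vt gt /=; lia.
split.
- apply: add_star_inj => //.
  + by move=> e1 e2 /pvt-> /pvt->.
  + by move=> a b; rewrite !inE => /orP[]/eqP-> /orP[]/eqP->; rewrite ?gv ?gt //; lia.
  + by move=> a e; rewrite !inE => /orP[]/eqP->; rewrite ?gv ?gt //; lia.
- apply: (add_star_ind (P := fun a => ((a == c) || (d < a)) && (a <= d + 5))) => //.
  + by move=> a; rewrite !inE => /orP[]/eqP->; rewrite ?gv ?gt; lia.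
  + by move=> e _; lia.
- move=> a b; rewrite !inE => /or3P[]/eqP-> /or3P[]/eqP->; rewrite ?Tu ?Tv ?Tt //; lia.
- by move=> a; rewrite !inE => /or3P[]/eqP->; rewrite ?Tu ?Tv ?Tt.
- by move=> a; rewrite !inE => /or3P[]/eqP->; rewrite ?Tu ?Tv ?Tt /=; lia.
Qed.

(* The star of the smallest vertex takes the labels [c, d+1, .., d+r-2] and
   [d+r-1+b], where [b] is chosen so that its sum avoids [S]; the label
   [d+r-b] that is left over plays the role of [c] for the remaining clique. *)
Definition star_label (c d r : nat) (b : bool) i :=
  if i == 0 then c else d + i + (b && (i == r.-1)).

Lemma sum_star_label c d r b : 2 < r ->
  \sum_(0 <= i < r) star_label c d r b i
    = \sum_(0 <= i < r) star_label c d r false i + b.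
Proof.
case: r => [//|r] r2; rewrite !big_nat_recr //= -addnA; congr (_ + _).
  apply: eq_big_nat => i /andP[_ ir].
  by rewrite /star_label /= (ltn_eqF ir) andbF.
by rewrite /star_label eqxx andbT /=; case: eqP; lia.
Qed.

(** Between the first label [c] and the last label [d + r - 1] there are [r - 2] labels, all from
    [d + 1] to [d + r - 2]. *)
Lemma sum_star_label_bounds c d r : 2 < r ->
  c + r.-1 * d.+1 <= \sum_(0 <= i < r) star_label c d r false i
    <= c + (r - 2) * (d + (r - 2)) + (d + r.-1).
Proof.
case: r => [//|[//|r]] r2; rewrite big_nat_recl // big_nat_recr //.
have -> : star_label c d r.+2 false 0 = c by [].
have -> : star_label c d r.+2 false r.+1 = d + r.+1 by rewrite /star_label /= addn0.
have lo : r * d.+1 <= \sum_(0 <= i < r) star_label c d r.+2 false i.+1.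
  have <- : \sum_(0 <= i < r) d.+1 = r * d.+1 by rewrite sum_nat_const_nat subn0.
  rewrite big_nat [leqRHS]big_nat.
  by apply: leq_sum => i ir; rewrite /star_label /=; lia.
have hi : \sum_(0 <= i < r) star_label c d r.+2 false i.+1 <= r * (d + r).
  have <- : \sum_(0 <= i < r) (d + r) = r * (d + r) by rewrite sum_nat_const_nat subn0.
  rewrite big_nat [leqRHS]big_nat.
  by apply: leq_sum => i ir; rewrite /star_label /=; lia.
by rewrite !subSS subn0 /= mulSn; apply/andP; split; lia.
Qed.

(** Induction on the clique down to the triangle, where the bound is [d + 5]. A star with [r] edges
    raises [d] by [r], which matches the drop from ['C(r.+1, 2)] to ['C(r, 2)]. *)
Lemma good_labelling_sorted s w (c d : nat) :
  uniq s -> 2 < size s -> sorted leq (map w s) -> c <= d ->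
  exists f, good_labelling w s c d (d + 'C(size s, 2) + 2) f.
Proof.
elim: s w c d => [//|u s IHs] w c d /= /andP[us uniq_s] ks srt cd.
have [k2|k3] : size s = 2 \/ 2 < size s by lia.
  case: s {IHs} k2 us uniq_s ks srt => [//|v [//|t [|//]]] _ us uniq_s _ srt.
  have [f Hf] : exists f, good_labelling w [:: u; v; t] c d (d + 5) f.
    case/and3P: srt => wuv wvt _; apply: good_labelling3 => //.
    by rewrite cons_uniq us.
  by exists f; rewrite -addnA.
set r := size s in k3.
pose sg := \sum_(0 <= i < r) star_label c d r false i.
pose A := w u + sg.
pose b := A \in S.
pose g x := star_label c d r b (index x s).
pose w' x := w x + g x.
have srt_s : sorted leq (map w s) by apply: path_sorted srt.
have wu x : x \in s -> w u <= w x.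
  move=> xs; have := order_path_min leq_trans srt.
  by move/allP; apply; apply: map_f.
have gmono i j : i < j -> j < r -> star_label c d r b i < star_label c d r b j.
  move=> ij jr; have ni : (i == r.-1) = false by lia.
  have nj : (j == 0) = false by lia.
  by rewrite /star_label ni nj andbF; case: eqP => _; lia.
(* Star labels increase along [s], so the new weights stay sorted. *)
have srt' : sorted leq (map w' s).
  apply/(sortedP 0) => i; rewrite size_map => ir.
  rewrite !(nth_map u) //; last exact: ltnW.
  rewrite /w' /g !index_uniq //; last exact: ltnW.
  apply: leq_add; last exact/ltnW/gmono.
  move/(sortedP 0): srt_s => /(_ i); rewrite size_map => /(_ ir).
  by rewrite !(nth_map u) //; apply: ltnW.
have [f [fI fR tI tS tB]] := IHs w' (d + r - b) (d + r) uniq_s k3 srt' (leq_subr _ _).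
have gs x : x \in s -> [/\ g x != d + r - b, g x <= d + r & (g x == c) || (d < g x)].
  rewrite -index_mem -/r /g /star_label => xr; have := leq_b1 b.
  case: (index x s =P 0) => [_|nx0] b1; first by split; lia.
  by case: (index x s =P r.-1) => [xl|nxl]; rewrite ?andbT ?andbF; split; lia.
have gc x : x \in s -> c <= g x by move/gs=> [_ _]; lia.
have gI : {in s &, injective g}.
  move=> x y xs ys gxy.
  suff : index x s = index y s by apply: (index_inj x).
  have := xs; have := ys; rewrite -!index_mem -/r => yr xr.
  case: (ltngtP (index x s) (index y s)) => // /gmono; rewrite -/(g x) -/(g y); lia.
have gsum : \sum_(x <- s) g x = sg + b.
  rewrite -sum_star_label // (big_nth u) -/r big_nat [RHS]big_nat.
  by apply: eq_bigr => i ir; rewrite /g index_uniq.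
have [q rq] : exists q, r = q.+2 by exists (r - 2); lia.
have rq2 : r - 2 = q by lia.
have rq1 : r.-1 = q.+1 by lia.
have /andP[] := sum_star_label_bounds c d k3; rewrite rq1 rq2 -/sg => slo shi.
have binS : 'C(r.+1, 2) = 'C(r, 2) + r by rewrite binS bin1.
have Tu : total w (add_star u g f) (u :: s) u = A + b.
  by rewrite total_add_star // gsum addnA.
have Tv x : x \in s -> total w (add_star u g f) (u :: s) x = total w' f s x.
  by move=> xs; rewrite total_add_star_neq.
(* With [r = q + 2], the lower bound on the total at [x] exceeds the upper bound on [A + b] by at
   least [3q + 1 - 2b], which is positive because [q >= 1]. *)
have Tlt x : x \in s -> A + b < total w' f s x.
  move=> xs; apply: leq_trans (tB x xs); have := wu x xs; have := gc x xs.
  rewrite /A /w' -/r rq2 => gcx wux.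
  have := leq_b1 b; move: shi; rewrite rq !mulnDr !mulnS; lia.
exists (add_star u g f); split.
- apply: add_star_inj => // x e xs /fR fe gfe.
  by have := gs x xs; case; move: fe; rewrite -gfe; lia.
- apply: (add_star_ind
      (P := fun a => ((a == c) || (d < a)) && (a <= d + 'C(r.+1, 2) + 2))) => //.
    move=> x /gs[_ ? ?]; lia.
  move=> e /fR; rewrite -/r; lia.
- move=> x y; rewrite !inE => /predU1P[->|xs] /predU1P[->|ys] //.
  + by rewrite Tu Tv //; have := Tlt y ys; lia.
  + by rewrite Tu Tv //; have := Tlt x xs; lia.
  + by rewrite !Tv //; apply: tI.
- move=> x; rewrite inE => /predU1P[->|xs]; last by rewrite Tv // tS.
  rewrite Tu; have [AS|AS] := boolP (A \in S); rewrite /b.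
    by rewrite AS; apply: (sparse3_notin spS AS); lia.
  by rewrite (negPf AS) addn0.
- move=> x; rewrite inE => /predU1P[->|xs] /=.
    rewrite Tu /A -/r (_ : r.+1 - 2 = q.+1); lia.
  rewrite Tv //; apply: leq_trans (tB x xs); have := gc x xs.
  rewrite /w' -/r rq2 (_ : r.+1 - 2 = q.+1); last by lia.
  by have := leq_b1 b; rewrite rq !mulnS !mulnDr; lia.
Qed.

End CliqueLabelling.

(** * Labelling the edges not inside the clique *)

Lemma injective_labelling (T : finType) (H : {set T}) (Q : seq nat) :
  uniq Q -> #|H| <= size Q ->
  exists f : T -> nat, {in H &, injective f} /\ {in H, forall x, f x \in Q}.
Proof.
move=> uQ leHQ.
have idx x : x \in H -> index x (enum H) < size Q.
  by move=> xH; apply: leq_trans leHQ; rewrite cardE index_mem mem_enum.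
exists (fun x => nth 0 Q (index x (enum H))); split=> [x y xH yH|x xH].
  move/eqP; rewrite nth_uniq ?idx // => /eqP.
  by apply: (index_inj x); rewrite ?mem_enum.
by rewrite mem_nth ?idx.
Qed.

Section OutsideLabelling.
Variables (V : finType) (adj : rel V) (K : {set V}).
Hypotheses (adj_sym : symmetric adj) (adj_irr : irreflexive adj).
Hypothesis domK : dominating adj K.

Lemma in_edgesP (e : {set V}) :
  reflect (exists x y, adj x y /\ e = [set x; y]) (e \in edges adj).
Proof.
apply: (iffP imsetP) => [[[x y]]|[x [y [xy ->]]]]; last first.
  by exists (x, y); rewrite ?inE.
by rewrite inE /= => xy ->; exists x, y.
Qed.

Lemma edge_adj x y : adj x y -> [set x; y] \in edges adj.
Proof. by move=> xy; apply/in_edgesP; exists x, y. Qed.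

Definition outer_edges := [set e in edges adj | ~~ (e \subset K)].

Lemma outer_edge x y : x \notin K -> adj x y -> [set x; y] \in outer_edges.
Proof.
move=> xK xy; rewrite inE edge_adj //=.
by apply: contra xK => /subsetP; apply; rewrite !inE eqxx.
Qed.

(** If [l] vertices lie outside [K], the largest reserved label is [3(l - 1) + 1], and the
    hypothesis bounds it by the number of outer edges. *)
Lemma outer_labelling : 3 * #|~: K| <= #|outer_edges| + 2 ->
  exists f, [/\ {in outer_edges, forall e, 0 < f e <= #|outer_edges|},
    {in outer_edges &, injective f} &
    {in ~: K &, forall u v, u != v ->
      (sigma adj f u + 3 <= sigma adj f v) || (sigma adj f v + 3 <= sigma adj f u)}].
Proof.
set E := outer_edges; set l := #|~: K| => lE.
(* By domination, the default [v] is never reached for [v] outside [K]. *)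
pose h v := odflt v [pick u in K | adj v u].
have hP v : v \in ~: K -> h v \in K /\ adj v (h v).
  rewrite inE => /domK[u uK uv]; rewrite /h; case: pickP => [x /andP[] //|/(_ u)].
  by rewrite uK adj_sym uv.
pose R v := [set v; h v].
(* The reserved edge [R v] has [v] as its only endpoint outside [K]. Hence [R] is injective, and [f]
   below can read [v] off the edge by summing over [e :\: K]. *)
have RD v : v \in ~: K -> R v :\: K = [set v].
  move=> vK; apply/setP => x; rewrite !inE; case: (eqVneq x v) => [->|xv] /=.
    by move: vK; rewrite inE => ->.
  by case: eqP => [->|]; rewrite ?andbF // (hP v vK).1.
have RI : {in ~: K &, injective R}.
  by move=> u v uK vK uv; apply: set1_inj; rewrite -(RD u) // -(RD v) // uv.
have RE : [set R v | v in ~: K] \subset E.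
  apply/subsetP => _ /imsetP[v vK ->]; apply: outer_edge; last by case: (hP v vK).
  by rewrite inE in vK.
pose H := E :\: [set R v | v in ~: K].
pose P := [seq (3 * j).+1 | j <- iota 0 l].
pose Q := [seq i <- iota 1 #|E| | i \notin P].
(* [H] omits exactly [l] of the edges in [E], while [Q] omits at most [l] of the labels from 1 to
   [#|E|]. *)
have cardH : #|H| <= size Q.
  rewrite cardsD (setIidPr RE) card_in_imset // -/l leq_subLR size_filter.
  rewrite -[leqLHS](size_iota 1) -(count_predC (mem P)) leq_add2r -size_filter.
  rewrite -[leqRHS](size_iota 0) -(size_map (fun j => (3 * j).+1)).
  apply: uniq_leq_size; first by rewrite filter_uniq ?iota_uniq.
  by move=> x; rewrite mem_filter => /andP[].
have [f0 [f0I f0Q]] := injective_labelling (filter_uniq _ (iota_uniq _ _)) cardH.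
pose s v := \sum_(u | adj v u && ([set v; u] \in H)) f0 [set v; u].
pose L := sort (relpre s leq) (enum (~: K)).
have inL v : (v \in L) = (v \in ~: K) by rewrite mem_sort mem_enum.
have idxL v : v \in ~: K -> index v L < l.
  by rewrite -inL -index_mem size_sort -cardE.
have sL u v : v \in ~: K -> index u L < index v L -> s u <= s v.
  move=> vK uv; have vL : index v L < size L by rewrite index_mem inL.
  have uL := ltn_trans uv vL.
  have srt : sorted (relpre s leq) L by apply: sort_sorted => x y; apply: leq_total.
  have tr : transitive (relpre s leq) by move=> y x z; apply: leq_trans.
  have := sorted_ltn_nth tr u srt _ _ uL vL uv.
  by rewrite /= !nth_index // -index_mem.
pose lab v := (3 * index v L).+1.
pose f e := if e \in H then f0 e else \sum_(x in e :\: K) lab x.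
have fR v : v \in ~: K -> f (R v) = lab v.
  by move=> vK; rewrite /f inE imset_f //= RD // big_set1.
have RH e : e \in E -> e \notin H -> exists2 v, v \in ~: K & e = R v.
  by move=> eE; rewrite inE eE andbT negbK => /imsetP.
have sigma_f v : v \in ~: K -> sigma adj f v = s v + lab v.
  move=> vK; have [hK vh] := hP v vK; rewrite /sigma (bigD1 (h v)) //=.
  rewrite -/(R v) fR // addnC; congr (_ + _); rewrite /s.
  (* A reserved edge containing [v] can only be [R v], so exactly one reserved label enters the sum
     at [v]. *)
  have vuH u : adj v u -> ([set v; u] \in H) = (u != h v).
    move=> vu; have vuE : [set v; u] \in E by apply: outer_edge => //; rewrite inE in vK.
    have [->|uh] := eqVneq u (h v); first by rewrite inE -/(R v) imset_f.
    apply: contraT => /(RH _ vuE)[x xK vux].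
    have vx : v = x.
      apply/set1P; rewrite -(RD x) // -vux !inE eqxx /=.
      by move: vK; rewrite inE => ->.
    have : u \in R x by rewrite -vux !inE eqxx orbT.
    rewrite -vx !inE (negPf uh) orbF => /eqP uv.
    by rewrite uv adj_irr in vu.
  apply: eq_big => [u|u]; first by case vu : (adj v u) => //=; rewrite vuH.
  by move=> /andP[vu uh]; rewrite /f vuH // uh.
have labP v : v \in ~: K -> lab v \in P.
  by move=> vK; apply/mapP; exists (index v L); rewrite ?mem_iota ?idxL.
have f0P e : e \in H -> (f0 e \notin P) /\ 0 < f0 e <= #|E|.
  by move=> /f0Q; rewrite mem_filter mem_iota add1n ltnS => /andP[].
exists f; split.
- move=> e eE; have [eH|/(RH _ eE)[v vK ->]] := boolP (e \in H).
    by rewrite /f eH; case: (f0P e eH).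
  by rewrite fR // /lab; have := idxL v vK; lia.
- move=> e1 e2 e1E e2E.
  have [e1H|/(RH _ e1E)[v1 v1K ->]] := boolP (e1 \in H);
  have [e2H|/(RH _ e2E)[v2 v2K ->]] := boolP (e2 \in H).
  + by rewrite /f e1H e2H; apply: f0I.
  + by rewrite fR // {1}/f e1H => e12; case: (f0P _ e1H); rewrite e12 labP.
  + by rewrite fR // {1}/f e2H => e12; case: (f0P _ e2H); rewrite -e12 labP.
  + rewrite !fR // /lab => /eqP; rewrite eqSS eqn_pmul2l // => /eqP i12.
    by congr R; apply: (index_inj v1) i12; rewrite inL.
- move=> u v uK vK uv; rewrite !sigma_f // /lab.
  have : index u L != index v L.
    apply: contra uv => /eqP iuv; apply/eqP.
    by apply: (index_inj u) iuv; rewrite inL.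
  rewrite neq_ltn => /orP[] ij; first by have := sL u v vK ij; lia.
  by have := sL v u uK ij; lia.
Qed.

End OutsideLabelling.

(** * Combining the two labellings *)

Lemma card_inner_edges (V : finType) (adj : rel V) (K : {set V}) :
  irreflexive adj -> clique adj K ->
  #|[set e in edges adj | e \subset K]| = 'C(#|K|, 2).
Proof.
move=> adj_irr cK; rewrite -cards_draws; apply: eq_card => e; rewrite !inE andbC.
have [eK|] //= := boolP (e \subset K).
apply/in_edgesP/cards2P => -[x [y [xy e_xy]]]; exists x, y; split=> //.
  by apply: contraTneq xy => ->; rewrite adj_irr.
by apply: cK => //; apply: (subsetP eK); rewrite e_xy !inE eqxx ?orbT.
Qed.

Theorem theorem5 (V : finType) (adj : rel V)
    (adj_sym : symmetric adj) (adj_irr : irreflexive adj)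
    (K : {set V}) (n m k : nat)
    (def_n : n = #|V|) (def_m : m = #|edges adj|) (def_k : k = #|K|)
    (domK : dominating_clique adj K) (k_ge3 : 3 <= k)
    (m_ge : 3 * (n - k) + (k * (k - 1)) %/ 2 <= m + 2) :
  antimagic adj 3.
Proof.
case: domK => cK dK.
set E := outer_edges adj K.
have card_E : m = #|E| + 'C(k, 2).
  rewrite def_m def_k -(card_inner_edges adj_irr cK).
  rewrite -(cardsID [set e : {set V} | e \subset K] (edges adj)) addnC.
  by congr (_ + _); apply: eq_card => e; rewrite !inE // andbC.
have card_Kc : #|~: K| = n - k by rewrite cardsCs setCK -def_n -def_k.
have [|f1 [f1R f1I f1S]] := outer_labelling adj_sym adj_irr dK.
  by rewrite card_Kc -/E; move: m_ge; rewrite card_E bin2 -divn2 subn1; lia.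
rewrite -/E in f1R f1I.
pose S := [pred x | [exists v, (v \notin K) && (sigma adj f1 v == x)]].
have spS : sparse3 S.
  move=> x y /existsP[u /andP[uK /eqP <-]] /existsP[v /andP[vK /eqP <-]] uv.
  have := f1S u v; rewrite !inE uK vK => /(_ isT isT).
  case: eqVneq => [uv'|_ /(_ isT)]; last by lia.
  by move: uv; rewrite uv' ltnn.
pose w u := \sum_(v | adj u v && (v \notin K)) f1 [set u; v].
pose s := sort (relpre w leq) (enum K).
have sz : size s = k by rewrite size_sort -cardE.
have in_s u : (u \in s) = (u \in K) by rewrite mem_sort mem_enum.
have uniq_s : uniq s by rewrite sort_uniq enum_uniq.
have srt : sorted leq (map w s).
  by rewrite sorted_map; apply: sort_sorted => x y; apply: leq_total.
(* With [c] and [d] both equal to [#|E| + 1], the labels available to the clique are exactly those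
   from [#|E| + 1] to [#|E| + 'C(k, 2) + 3 = m + 3]. *)
have [|f2] := good_labelling_sorted spS uniq_s _ srt (leqnn #|E|.+1).
  by rewrite sz.
rewrite sz => -[f2I f2R f2T f2S _].
pose f (e : {set V}) := if e \subset K then f2 e else f1 e.
have inner (e : {set V}) : e \in edges adj -> e \subset K -> pair_in s e.
  move=> /in_edgesP[x [y [xy ->]]] /subsetP xyK.
  apply: pair_in_set2; rewrite ?in_s ?xyK ?inE ?eqxx ?orbT //.
  by apply: contraTneq xy => ->; rewrite adj_irr.
have outer (e : {set V}) : e \in edges adj -> ~~ (e \subset K) -> e \in E.
  by move=> eE eK; rewrite inE eE.
have sigma_out v : v \notin K -> sigma adj f v = sigma adj f1 v.
  move=> vK; apply: eq_bigr => u vu; rewrite /f ifN //.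
  by have := outer_edge vK vu; rewrite inE => /andP[].
have sigma_in u : u \in K -> sigma adj f u = total w f2 s u.
  move=> uK; rewrite /sigma (bigID (mem K)) /= addnC /total; congr (_ + _).
    apply: eq_bigr => v /andP[_ vK]; rewrite /f ifN //.
    by apply: contra vK => /subsetP; apply; rewrite !inE eqxx orbT.
  rewrite [RHS](perm_big (enum K)) ?perm_sort // big_enum_cond /=.
  apply: eq_big => v; last first.
    by case/andP=> _ vK; rewrite /f ifT // subUset !sub1set uK.
  rewrite andbC; have [vK|] //= := boolP (v \in K).
  have [->|vu] := eqVneq v u; first exact: adj_irr.
  by apply: cK; rewrite // eq_sym.
exists f; split.
- move=> e eE; rewrite /f -def_m; case: ifPn => eK.
    by have := f2R e (inner e eE eK); rewrite card_E; lia.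
  by have := f1R e (outer e eE eK); rewrite card_E; lia.
- move=> e1 e2 e1E e2E; rewrite /f; case: ifPn => e1K; case: ifPn => e2K.
  + by apply: f2I; apply: inner.
  + by have := f2R e1 (inner _ e1E e1K); have := f1R e2 (outer _ e2E e2K); lia.
  + by have := f1R e1 (outer _ e1E e1K); have := f2R e2 (inner _ e2E e2K); lia.
  + by apply: f1I; apply: outer.
- move=> u v; have [uK|uK] := boolP (u \in K); have [vK|vK] := boolP (v \in K).
  + by rewrite !sigma_in //; apply: f2T; rewrite in_s.
  + rewrite sigma_in // sigma_out // => uv; have := f2S u; rewrite in_s => /(_ uK).
    by case/existsP; exists v; rewrite vK uv /=.
  + rewrite sigma_out // sigma_in // => uv; have := f2S v; rewrite in_s => /(_ vK).
    by case/existsP; exists u; rewrite uK uv /=.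
  + rewrite !sigma_out // => uv; apply: contraTeq isT => nuv.
    by have := f1S u v; rewrite !inE uv => /(_ uK vK nuv); lia.
Qed.
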